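(* Let $u$ be a weight on $\mathbb R$ and $w$ a weight on $(0,\infty)$. If $H:\Lambda^p_u(w)\to\Lambda^{p,\infty}_u(w)$ is bounded for some $0<p<\infty$, then $w\in B^*_\infty$.
   Context: A weight $u$ on $\mathbb R$ is locally integrable with $u>0$ a.e.; $u(E)=\int_Eu$. A weight $w$ on $(0,\infty)$ is nonnegative locally integrable, $W(t)=\int_0^tw$. $f^*_u(t)=\inf\{y>0:u(\{|f|>y\})\le t\}$; $\|f\|_{\Lambda^p_u(w)}=\left(\int_0^\infty(f^*_u)^pw\right)^{1/p}$, $\|f\|_{\Lambda^{p,\infty}_u(w)}=\sup_{t>0}f^*_u(t)W(t)^{1/p}$. $Hf(x)=\frac1\pi\lim_{\varepsilon\to0^+}\int_{|x-y|>\varepsilon}\frac{f(y)}{x-y}dy$; boundedness of $H$ means $Hf$ defined a.e. for every $f\in\Lambda^p_u(w)$ with $\|Hf\|_{\Lambda^{p,\infty}_u(w)}\le C\|f\|_{\Lambda^p_u(w)}$. $w\in B^*_\infty$: there is $C>0$ with $\int_0^r\frac{W(t)}t\,dt\le CW(r)$ for all $r>0$. *)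

(* Defs.v *)
From HB Require Import structures.
From mathcomp Require Import all_boot all_order all_algebra.
From mathcomp Require Import all_classical all_reals all_analysis.
Set Implicit Arguments. Unset Strict Implicit. Unset Printing Implicit Defensive.
Import Order.TTheory GRing.Theory Num.Theory.
Import numFieldNormedType.Exports.
Local Open Scope classical_set_scope.
Local Open Scope ring_scope.

Section Defs.
Context {R : realType}.
Local Notation mu := (@lebesgue_measure R).

Definition weightR (u : R -> R) : Prop :=
  (forall a b : R, mu.-integrable `[a, b] (EFin \o u)) /\
  {ae mu, forall x, 0 < u x}.

(** weight on (0,oo): nonnegative, locally integrable
    (integrable on (0,t] for every t > 0, so that W(t) is finite). *)
Definition weightRp (w : R -> R) : Prop :=
  (forall t : R, 0 < t -> 0 <= w t) /\
  (forall t : R, 0 < t -> mu.-integrable `]0%R, t] (EFin \o w)).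

Definition umeas (u : R -> R) (E : set R) : \bar R :=
  (\int[mu]_(x in E) (u x)%:E)%E.

Definition Wfun (w : R -> R) (t : R) : \bar R :=
  (\int[mu]_(s in `]0%R, t]) (w s)%:E)%E.

Definition rearr (u f : R -> R) (t : R) : \bar R :=
  ereal_inf [set y%:E | y in [set y : R | 0 < y /\
     (umeas u [set x | (y < `|f x|)%R] <= t%:E)%E]].

Definition lorentz_int (u w : R -> R) (p : R) (f : R -> R) : \bar R :=
  (\int[mu]_(t in `]0%R, +oo[) (poweR (rearr u f t) p * (w t)%:E))%E.

Definition lorentz_norm (u w : R -> R) (p : R) (f : R -> R) : \bar R :=
  poweR (lorentz_int u w p f) p^-1.

Definition in_lorentz (u w : R -> R) (p : R) (f : R -> R) : Prop :=
  measurable_fun setT f /\ (lorentz_int u w p f < +oo)%E.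

Definition weak_lorentz_norm (u w : R -> R) (p : R) (f : R -> R) : \bar R :=
  ereal_sup [set (rearr u f t * poweR (Wfun w t) p^-1)%E | t in `]0%R, +oo[].

Definition hilbert_trunc (f : R -> R) (e x : R) : R :=
  pi^-1 * fine (\int[mu]_(y in [set y : R | (e < `|x - y|)%R]) (f y / (x - y))%:E)%E.

Definition hilbert_pv (f : R -> R) (x l : R) : Prop :=
  (forall e : R, 0 < e ->
     mu.-integrable [set y : R | (e < `|x - y|)%R] (fun y => (f y / (x - y))%:E)) /\
  (hilbert_trunc f e x @[e --> 0^'+] --> l).

Definition hilbert_bounded (u w : R -> R) (p : R) : Prop :=
  exists C : R, forall f : R -> R, in_lorentz u w p f ->
    exists Hf : R -> R, measurable_fun setT Hf /\
      {ae mu, forall x, hilbert_pv f x (Hf x)} /\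
      (weak_lorentz_norm u w p Hf <= C%:E * lorentz_norm u w p f)%E.

Definition B_star_infty (w : R -> R) : Prop :=
  exists C : R, 0 < C /\ forall r : R, 0 < r ->
    (\int[mu]_(t in `]0%R, r]) (Wfun w t * (t^-1)%:E) <= C%:E * Wfun w r)%E.

End Defs.

(* Main.v *)
Require Import Defs.
From HB Require Import structures.
From mathcomp Require Import all_boot all_order all_algebra.
From mathcomp Require Import all_classical all_reals all_analysis.
From mathcomp Require Import measurable_realfun ring lra.
Import Order.TTheory GRing.Theory Num.Theory.
Import numFieldNormedType.Exports.
Local Open Scope classical_set_scope.
Local Open Scope ring_scope.

(** Write [U] for the measure [u(x) dx].  First, [U(R)] is infinite, since
    otherwise the constant [1] lies in the Lorentz space although its truncated
    Hilbert transforms diverge.  For every [r > 0] and [N] a stopping-time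
    argument then produces an interval [E = ]b - h/2, b]] with [U(E) <= r] whose
    right neighbour [J = ]b, b + h/N]] satisfies [U(J) >= r/N].  On [J] the
    Hilbert transform of the indicator of [E] is at least [ln(1 + N/2) / pi],
    with no principal value involved, so the weak-type bound gives
    [ln(1 + N/2) W(t)^(1/p) <= C W(r)^(1/p)] for [t < r/N].  For [N] large this
    is [2 W(r/K) <= W(r)] with [K = 2N], and summing the geometric decay of [W]
    over the shells []r/K^(n+1), r/K^n]] bounds the integral of [W(t)/t]. *)

(** * The measure [u(x) dx]: monotonicity, additivity and absolute continuity *)

Section umeas.
Context {R : realType}.
Local Notation mu := (@lebesgue_measure R).
Implicit Types (u : R -> R) (A B : set R).

Lemma lebesgue_aeS (P Q : R -> Prop) : (forall x, P x -> Q x) ->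
  {ae mu, forall x, P x} -> {ae mu, forall x, Q x}.
Proof.
by move=> PQ; apply: filterS PQ; exact: (ae_filter_ringOfSetsType mu).
Qed.

Lemma weightR_measurable u : weightR u -> measurable_fun setT u.
Proof.
move=> [ui _].
have -> : [set: R] = \bigcup_n `[- n%:R, n%:R]%classic.
  apply/seteqP; split=> // x _; exists (Num.truncn `|x|).+1 => //=.
  have := ltW (truncnS_gt `|x|); rewrite ler_norml.
  by rewrite in_itv/=.
apply/measurable_fun_bigcup => [//|n].
by apply/measurable_EFinP; exact: measurable_int (ui _ _).
Qed.

(** As [u] is positive only almost everywhere, passing to its absolute value makes the integrand
    nonnegative at every point, as the lemmas on nonnegative integrals require. *)
Lemma umeasE u A : weightR u -> measurable A ->
  umeas u A = (\int[mu]_(x in A) `|u x|%:E)%E.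
Proof.
move=> wu mA; have mu_ := weightR_measurable _ wu.
apply: ae_eq_integral => //.
- by apply/measurable_EFinP; exact: measurable_funTS.
- by apply/measurable_EFinP; apply: measurable_funTS; exact: measurableT_comp.
- by case: wu => _; apply: lebesgue_aeS => x u0 _ /=; rewrite gtr0_norm.
Qed.

Lemma umeas_ge0 u A : weightR u -> measurable A -> (0 <= umeas u A)%E.
Proof.
by move=> wu mA; rewrite umeasE//; apply: integral_ge0 => x _; rewrite lee_fin.
Qed.

(** Inclusion up to a null set is the form that fits [Hf], which is known only almost everywhere. *)
Lemma le_ae_umeas u A B : weightR u -> measurable A -> measurable B ->
  {ae mu, forall x, A x -> B x} -> (umeas u A <= umeas u B)%E.
Proof.
move=> wu mA mB AB; have mu_ := weightR_measurable _ wu.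
rewrite !umeasE// [leLHS]integral_mkcond [leRHS]integral_mkcond.
have mnu : measurable_fun setT (fun x => `|u x|%:E).
  by apply/measurable_EFinP; exact: measurableT_comp.
have patch0 D x : (0 <= ((fun x => `|u x|%:E) \_ D) x)%E.
  by rewrite patchE; case: ifPn => // _; rewrite lee_fin.
apply: ae_ge0_le_integral => //.
- by apply/(measurable_restrictT _ mA); exact: measurable_funTS.
- by apply/(measurable_restrictT _ mB); exact: measurable_funTS.
apply: lebesgue_aeS AB => x AB _; rewrite !patchE; case: ifPn => [|_].
  by rewrite inE => /AB ?; rewrite mem_set.
by case: ifPn => // _; rewrite lee_fin.
Qed.

Lemma le_umeas u A B : weightR u -> measurable A -> measurable B ->
  A `<=` B -> (umeas u A <= umeas u B)%E.
Proof. by move=> ? ? ? AB; apply: le_ae_umeas => //; apply: aeW => x /AB. Qed.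

Lemma umeas_itvD u (a b c : R) : weightR u -> a <= b -> b <= c ->
  umeas u `]a, c] = (umeas u `]a, b] + umeas u `]b, c])%E.
Proof.
move=> wu ab bc; have mu_ := weightR_measurable _ wu.
rewrite !umeasE// -ge0_integral_setU//=.
- by rewrite -itv_bndbnd_setU ?bnd_simp.
- by apply/measurable_EFinP; apply: measurable_funTS; exact: measurableT_comp.
- apply/disj_setPS => x [/=]; rewrite !in_itv/= => /andP[_ xb] /andP[bx _].
  by have := lt_le_trans bx xb; rewrite ltxx.
Qed.

Lemma umeas_itv_lt_mul u (c s m : R) (n : nat) : weightR u -> 0 <= s ->
  (forall i, (i < n.+1)%N ->
    (umeas u `](c + i%:R * s)%R, (c + i.+1%:R * s)%R] < m%:E)%E) ->
  (umeas u `]c, (c + n.+1%:R * s)%R] < (n.+1%:R * m)%:E)%E.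
Proof.
move=> wu s0; elim: n => [/(_ 0%N isT)|n ih lt_m].
  by rewrite mul0r addr0 !mul1r.
rewrite (@umeas_itvD _ _ (c + n.+1%:R * s))//; last 2 first.
- by rewrite lerDl mulr_ge0.
- by rewrite lerD2l ler_wpM2r// ler_nat.
have -> : n.+2%:R * m = n.+1%:R * m + m by rewrite -[in LHS]natr1 mulrDl mul1r.
rewrite EFinD; apply: lteD; last exact: lt_m.
by apply: ih => i ni; apply: lt_m; exact: ltnW.
Qed.

(** Pigeonhole, by contraposition of the strict bound above. *)
Lemma umeas_heavy_piece u (c s m : R) (n : nat) : weightR u -> 0 <= s ->
  ((n.+1%:R * m)%:E <= umeas u `]c, (c + n.+1%:R * s)%R])%E ->
  exists2 i, (i < n.+1)%N &
    (m%:E <= umeas u `](c + i%:R * s)%R, (c + i.+1%:R * s)%R])%E.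
Proof.
move=> wu s0; apply: contraPP => /forall2NP H; apply/negP; rewrite -ltNge.
apply: umeas_itv_lt_mul => // i ni.
by case: (H i) => [/(_ ni)//|/negP]; rewrite -ltNge.
Qed.

(** As [u] is only locally integrable, absolute continuity is applied to its cut-off to [[a, b]]. *)
Lemma umeas_unif_cont u (a b e : R) : weightR u -> 0 < e ->
  exists2 d : R, 0 < d & forall A, measurable A -> A `<=` `[a, b] ->
    (mu A < d%:E)%E -> (umeas u A < e%:E)%E.
Proof.
move=> wu e0; have [ui _] := wu.
have /= := @integral_normr_continuous _ _ _ mu (u \_ `[a, b]) _ e e0.
case=> [|d [d0 H]].
  rewrite (_ : _ \o _ = (EFin \o u) \_ `[a, b]); last first.
    by apply/funext => x/=; rewrite !patchE; case: ifPn.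
  by apply/(integrable_mkcond _ _).1.
exists d => // A mA Aab muA; rewrite umeasE//.
have := H A mA muA; rewrite /Rintegral.
have -> : (\int[mu]_(x in A) (`|(u \_ `[a, b]) x|)%:E)%E =
          (\int[mu]_(x in A) (`|u x|)%:E)%E.
  by apply: eq_integral => x; rewrite inE => /Aab abx; rewrite patchE mem_set.
move=> le_e; rewrite -[ltLHS]fineK ?lte_fin//.
rewrite ge0_fin_numE; last by apply: integral_ge0 => x _; rewrite lee_fin.
have : mu.-integrable A (EFin \o u) by apply: integrableS (ui a b).
by move=> /integrableP[].
Qed.

End umeas.

(** * Selection of a light interval with a heavy right neighbour *)

Section selection.
Context {R : realType}.
Local Notation mu := (@lebesgue_measure R).

(** Monotone convergence over the intervals []-n, n]], which exhaust the line. *)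
Lemma umeas_setT_le (u : R -> R) (r : R) : weightR u ->
  (forall n : nat, (umeas u `](- n%:R)%R, n%:R] <= r%:E)%E) ->
  (umeas u setT <= r%:E)%E.
Proof.
move=> wu le_r; have mu_ := weightR_measurable _ wu.
pose F (n : nat) := `]- n%:R, n%:R]%classic : set R.
have FT : \bigcup_n F n = [set: R].
  apply/seteqP; split=> // x _; exists (Num.truncn `|x|).+1 => //.
  have := truncnS_gt `|x|; rewrite ltr_norml /F/= in_itv/= => /andP[-> /ltW ->].
  by [].
rewrite umeasE// -FT.
have FE n : (\int[mu]_(x in F n) `|u x|%:E)%E = umeas u (F n).
  by rewrite umeasE//; exact: measurable_itv.
have : (\int[mu]_(x in F n) `|u x|%:E)%E @[n --> \oo] -->
       (\int[mu]_(x in \bigcup_n F n) `|u x|%:E)%E.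
  apply: ge0_nondecreasing_set_cvg_integral => //.
  - move=> m n mn; apply/subsetPset => x; rewrite /F/= !in_itv/=.
    have : (m%:R <= n%:R :> R) by rewrite ler_nat.
    by move=> ? /andP[? ?]; apply/andP; split; lra.
  - by move=> n; exact: measurable_itv.
  - move=> n; apply/measurable_EFinP; apply: measurable_funTS.
    exact: measurableT_comp.
move=> /[dup] cF /cvg_lim <-//.
apply: lime_le; first exact: cvgP cF.
by apply: nearW => n; rewrite FE; exact: le_r.
Qed.

(* A heavy subinterval of a heavy interval [I] either has a light left
   neighbour of length [|I| / 2] or this neighbour is again heavy; absolute
   continuity forbids the second alternative to recur forever. *)
Lemma umeas_selection (u : R -> R) (r c l : R) (n : nat) :
  weightR u -> 0 < r -> 0 < l ->
  (r%:E <= umeas u `]c, (c + l)%R])%E ->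
  exists b h : R, [/\ 0 < h,
    (umeas u `](b - h / 2)%R, b] <= r%:E)%E &
    ((r / n.+1%:R)%:E <= umeas u `]b, (b + h / n.+1%:R)%R])%E].
Proof.
move=> wu r0 l0 rcl; apply: contrapT => Hno.
(* Each step moves the left endpoint left by at most half the current length, so the total drift
   stays below [l] and all intervals lie in [[c - l, c + l]]. *)
have step k : exists a : R, [/\ c - l + l / 2 ^+ k <= a,
    a + l / 2 ^+ k <= c + l & (r%:E <= umeas u `]a, (a + l / 2 ^+ k)%R])%E].
  elim: k => [|k [a [ca al ra]]].
    by exists c; rewrite expr0 divr1; split => //; rewrite subrK.
  set h := l / 2 ^+ k in ca al ra *.
  have h0 : 0 < h by rewrite divr_gt0// exprn_gt0.
  have hE : l / 2 ^+ k.+1 = h / 2 by rewrite exprS invfM mulrCA mulrC.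
  have n0 : n.+1%:R != 0 :> R by rewrite pnatr_eq0.
  have s0 : 0 <= h / n.+1%:R by rewrite divr_ge0// ltW.
  have [|i ni ri] := @umeas_heavy_piece _ u a (h / n.+1%:R) (r / n.+1%:R) n wu s0.
    by rewrite !(mulrC n.+1%:R) !divfK.
  set b := a + i%:R * (h / n.+1%:R) in ri.
  have bE : a + i.+1%:R * (h / n.+1%:R) = b + h / n.+1%:R.
    by rewrite /b -addrA -natr1 mulrDl mul1r.
  have ab : a <= b by rewrite lerDl mulr_ge0.
  have bah : b + h / n.+1%:R <= a + h.
    rewrite -bE lerD2l -[leRHS](divfK n0) mulrC ler_wpM2l// ler_nat//.
  have {}bah : b <= a + h by apply: le_trans bah; rewrite lerDl.
  (* By [Hno], the left neighbour of the heavy piece has mass above [r], so it serves as the next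
     interval. *)
  exists (b - h / 2); rewrite hE subrK; split; [lra|lra|].
  rewrite bE in ri; apply: ltW; rewrite ltNge; apply/negP => rb.
  by apply: Hno; exists b, h.
(* Intervals of mass at least [r] inside a fixed window cannot be arbitrarily short. *)
have [d d0 Hd] := @umeas_unif_cont _ u (c - l) (c + l) r wu r0.
have [k kd] : exists k, l / 2 ^+ k < d.
  exists (Num.truncn (l / d)).+1; rewrite ltr_pdivrMr ?exprn_gt0// mulrC.
  rewrite -ltr_pdivrMr//; apply: lt_trans (truncnS_gt _) _.
  by rewrite -natrX ltr_nat ltn_expl.
have [a [ca al ra]] := step k.
have h0 : 0 < l / 2 ^+ k by rewrite divr_gt0// exprn_gt0.
have : (umeas u `]a, (a + l / 2 ^+ k)%R] < r%:E)%E.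
  apply: Hd => //.
  - by move=> x /=; rewrite !in_itv/= => /andP[? ?]; apply/andP; split; lra.
  - by rewrite lebesgue_measure_itv/= lte_fin ltrDl h0 -EFinB addrAC subrr add0r lte_fin.
by rewrite ltNge ra.
Qed.

End selection.

(** * The Cauchy kernel on an interval away from its singularity *)

Section kernel.
Context {R : realType}.
Local Notation mu := (@lebesgue_measure R).

(** A primitive in [y] is [- ln (x - y)], smooth up to [b] because [b < x]. *)
Lemma integral_cauchy_kernel (b L x : R) : 0 < L -> b < x ->
  (\int[mu]_(y in `](b - L)%R, b]) ((x - y)^-1)%:E)%E =
  (ln (1 + L / (x - b)))%:E.
Proof.
move=> L0 bx.
pose F : R -> R := fun y => - ln (x - y).
have dF y : y < x -> is_derive y 1 F (x - y)^-1.
  move=> yx; have xy0 : 0 < x - y by rewrite subr_gt0.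
  have := is_derive1_ln xy0 => dln.
  have : is_derive y 1 (fun z : R => x - z) (-1).
    by apply: is_derive_eq; rewrite add0r mul1r.
  by move=> dsub; have /is_deriveN := @is_derive1_comp _ (@ln R) (fun z => x - z) y _ _ dln dsub; rewrite mulrN1 opprK.
have cF y : y < x -> {for y, continuous F}.
  by move=> yx; apply/differentiable_continuous/derivable1_diffP; have [] := dF y yx.
have ck y : y < x -> {for y, continuous (fun y => (x - y)^-1)}.
  move=> yx; apply: cvgV; first by rewrite subr_eq0 gt_eqF.
  by apply: cvgB; [exact: cvg_cst|exact: cvg_id].
have bLb : b - L < b by rewrite ltrBlDr ltrDl.
have mk : measurable_fun `](b - L), b] (fun y : R => ((x - y)^-1)%:E).
  apply/measurable_EFinP.
  apply: (@measurable_funS _ _ _ _ `]-oo, x[) => //.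
    by move=> y /=; rewrite !in_itv/= => /andP[_ yb]; exact: le_lt_trans bx.
  apply: open_continuous_measurable_fun; first exact: interval_open.
  by move=> y; rewrite inE/= in_itv/=; exact: ck.
rewrite integral_itv_obnd_cbnd//.
rewrite (@continuous_FTC2 _ _ F (b - L) b bLb).
- rewrite /F -EFinB; congr EFin.
  rewrite opprK addrC -ln_div ?posrE ?subr_gt0//; last exact: lt_trans bx.
  congr ln. rewrite opprB addrA addrAC mulrDl divff// gt_eqF// subr_gt0//.
- apply: continuous_in_subspaceT => y; rewrite inE/= in_itv/= => /andP[_ yb].
  by apply: ck; exact: le_lt_trans bx.
- split.
  + by move=> y; rewrite in_itv/= => /andP[_ yb]; have [] := dF _ (lt_trans yb bx).
  + by apply: cvg_at_right_filter; apply: cF; exact: lt_trans bx.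
  + by apply: cvg_at_left_filter; exact: cF.
- move=> y; rewrite in_itv/= => /andP[_ yb].
  by have /@derive_val := dF _ (lt_trans yb bx); rewrite derive1E.
Qed.

End kernel.

(** * Rearrangements and Lorentz integrals of indicators *)

Section lorentz.
Context {R : realType}.
Local Notation mu := (@lebesgue_measure R).
Implicit Types (u w f : R -> R).

Lemma weightRp_measurable w (t : R) : weightRp w ->
  measurable_fun `]0%R, t] (EFin \o w).
Proof.
move=> [_ wi]; have [t0|t0] := ltP 0 t; first exact: measurable_int (wi _ t0).
by rewrite set_itv_ge ?bnd_simp -?leNgt//; exact: measurable_fun_set0.
Qed.

Lemma Wfun_ge0 w (t : R) : weightRp w -> (0 <= Wfun w t)%E.
Proof.
move=> [w0 _]; apply: integral_ge0 => s /=; rewrite in_itv/= => /andP[s0 _].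
by rewrite lee_fin w0.
Qed.

Lemma Wfun_fin_num w (t : R) : weightRp w -> Wfun w t \is a fin_num.
Proof.
move=> ww; have [t0|t0] := ltP 0 t.
  by have [_ wi] := ww; exact: integrable_fin_num (wi _ t0).
by rewrite /Wfun set_itv_ge ?bnd_simp -?leNgt// integral_set0.
Qed.

Lemma le_Wfun w (s t : R) : weightRp w -> s <= t -> (Wfun w s <= Wfun w t)%E.
Proof.
move=> ww st; apply: ge0_subset_integral => //=.
- exact: weightRp_measurable.
- by move=> x; rewrite in_itv/= lee_fin => /andP[x0 _]; case: ww => + _; apply.
- by apply: subset_itvl; rewrite bnd_simp.
Qed.

Lemma rearr_ge_of_level u f (l t : R) :
  (forall y : R, 0 < y -> y < l ->
     (t%:E < umeas u [set x | (y < `|f x|)%R])%E) ->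
  (l%:E <= rearr u f t)%E.
Proof.
move=> H; apply/ereal_infP => _ [y [y0 yt] <-]; rewrite lee_fin leNgt.
by apply/negP => yl; move: yt; rewrite leNgt H.
Qed.

(** The level set of [\1_E] at height [y] is [E] for [0 < y < 1] and empty for [y >= 1]. *)
Lemma rearr_indic u (E : set R) (t : R) : 0 <= t ->
  rearr u (\1_E) t = if (umeas u E <= t%:E)%E then 0%E else 1%E.
Proof.
move=> t0.
have lvl1 (y : R) : 0 < y -> y < 1 -> [set x | (y < `|\1_E x : R|)%R] = E.
  move=> y0 y1; apply/seteqP; split=> x /=; rewrite indicE.
    by case: (boolP (x \in E)) => [/set_mem//|_]; rewrite normr0 ltNge ltW.
  by move=> Ex; rewrite mem_set//= normr1.
have lvl0 (y : R) : 1 <= y -> [set x | (y < `|\1_E x : R|)%R] = set0.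
  move=> y1; apply/seteqP; split=> x //=; rewrite indicE ltNge => /negP; apply.
  by apply: le_trans y1; case: (x \in E); rewrite ?normr1 ?normr0.
have um0 : umeas u set0 = 0%E by rewrite /umeas integral_set0.
have [Et|Et] := leP (umeas u E) t%:E; apply/eqP; rewrite eq_le; apply/andP; split.
- apply/lee_addgt0Pr => e e0; rewrite add0e; apply: ereal_inf_lbound.
  exists e => //; split=> //; have [e1|e1] := ltP e 1; first by rewrite lvl1.
  by rewrite lvl0// um0 lee_fin.
- by apply/ereal_infP => _ [y [y0 _] <-]; rewrite lee_fin ltW.
- by apply: ereal_inf_lbound; exists 1 => //; split; rewrite ?ltr01// lvl0// um0 lee_fin.
- by apply: rearr_ge_of_level => y y0 y1; rewrite lvl1.
Qed.

(** On the half-line the rearrangement of [\1_E] is the indicator of []0, u(E)[], and this interval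
    lies in []0, r]]. *)
Lemma lorentz_int_indic u w (p r : R) (E : set R) :
  weightR u -> weightRp w -> 0 < p -> measurable E -> (umeas u E <= r%:E)%E ->
  (lorentz_int u w p (\1_E) <= Wfun w r)%E.
Proof.
move=> wu ww p0 mE Er.
have E0 := umeas_ge0 _ _ wu mE.
have /fineK mEf : umeas u E \is a fin_num by rewrite ge0_fin_numE// (le_lt_trans Er)// ltry.
set m := fine (umeas u E) in mEf.
have mr : m <= r by rewrite -lee_fin mEf.
have -> : lorentz_int u w p (\1_E) = (\int[mu]_(t in `]0%R, m[) (w t)%:E)%E.
  have -> : `]0%R, m[%classic = `]0%R, +oo[%classic `&` `]-oo, m[%classic :> set R.
    by apply/seteqP; split=> x /=; rewrite !in_itv/= andbT => /andP.
  rewrite integral_mkcondr; apply: eq_integral => t.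
  rewrite inE/= in_itv/= andbT => t0.
  rewrite (rearr_indic _ _ _ (ltW t0)) -mEf lee_fin patchE.
  have [mt|mt] := leP m t.
    rewrite poweR0r ?gt_eqF// mul0e memNset//= in_itv/=.
    by apply/negP; rewrite -leNgt.
  by rewrite poweR1r mul1e mem_set//= in_itv/=.
apply: ge0_subset_integral => //=.
- exact: weightRp_measurable.
- by move=> x; rewrite in_itv/= lee_fin => /andP[x0 _]; case: ww => + _; apply.
- by move=> x /=; rewrite !in_itv/= => /andP[-> /ltW xm]; exact: le_trans mr.
Qed.

Lemma in_lorentz_indic u w (p r : R) (E : set R) :
  weightR u -> weightRp w -> 0 < p -> measurable E -> (umeas u E <= r%:E)%E ->
  in_lorentz u w p (\1_E).
Proof.
move=> wu ww p0 mE Er; split; first exact: measurable_indic.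
apply: le_lt_trans (lorentz_int_indic _ _ _ _ _ wu ww p0 mE Er) _.
by rewrite ltey_eq Wfun_fin_num.
Qed.

End lorentz.

(** * Hilbert transforms of interval indicators and of the constant [1] *)

Section hilbert.
Context {R : realType}.
Local Notation mu := (@lebesgue_measure R).
Implicit Types (u w f : R -> R).

(** For [e < x - b] the truncation removes no point of the interval, so the value does not depend on
    [e]. *)
Lemma hilbert_trunc_indic_itv (b L e x : R) : 0 < L -> 0 < e < x - b ->
  hilbert_trunc (\1_(`](b - L)%R, b])) e x = pi^-1 * ln (1 + L / (x - b)).
Proof.
move=> L0 /andP[e0 eb]; rewrite /hilbert_trunc; congr (_ * _).
have bx : b < x by rewrite -subr_gt0; exact: lt_trans eb.
rewrite -[RHS]/(fine (ln (1 + L / (x - b)))%:E) -integral_cauchy_kernel//.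
have sub : `](b - L)%R, b]%classic `<=` [set y : R | (e < `|x - y|)%R].
  move=> y /=; rewrite in_itv/= => /andP[_ yb].
  by apply: lt_le_trans (ler_norm _); lra.
rewrite -[in RHS](setIidr sub) integral_mkcondr; congr fine.
apply: eq_integral => y _; rewrite patchE indicE.
by case: (y \in _); rewrite ?mul1r ?mul0r.
Qed.

Lemma hilbert_pv_indic_itv (b L x l : R) : 0 < L -> b < x ->
  hilbert_pv (\1_(`](b - L)%R, b])) x l -> l = pi^-1 * ln (1 + L / (x - b)).
Proof.
move=> L0 bx [_ cl]; apply: (cvg_unique _ cl) => //.
apply: cvg_near_cst.
near=> e; apply: hilbert_trunc_indic_itv => //; apply/andP; split => //.
near: e; apply: nbhs_right_lt; rewrite subr_gt0//.
Unshelve. all: by end_near. Qed.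

(** For the constant [1] this refutes the integrability clause of [hilbert_pv] at radius [1]: the
    integrals over []b - L, b]] grow logarithmically in [L]. *)
Lemma cauchy_kernel_not_integrable (x : R) :
  ~ mu.-integrable [set y : R | (1 < `|x - y|)%R]
      (fun y => (\1_[set: R] y / (x - y))%:E).
Proof.
set S := [set y : R | _]; set k := (fun y => _) => ki.
pose b := x - 2.
have bx : b < x by rewrite /b; lra.
have mS : measurable S.
  have -> : S = (fun y => `|x - y|) @^-1` `]1, +oo[.
    by apply/seteqP; split=> y /=; rewrite in_itv/= andbT.
  rewrite -[X in measurable X]setTI.
  by apply: (measurableT_comp (@normr_measurable R setT) _) => //; exact: measurable_funB.
pose M := fine (\int[mu]_(y in S) `|k y|)%E.
have ME : (\int[mu]_(y in S) `|k y|)%E = M%:E.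
  rewrite fineK// ge0_fin_numE; last exact: integral_ge0.
  by move/integrableP : ki => [].
(* As [x - b = 2], the integral becomes [ln (1 + expR M)], which exceeds [M]. *)
pose L : R := 2 * expR M.
have L0 : 0 < L by rewrite mulr_gt0// expR_gt0.
have sub : `](b - L)%R, b]%classic `<=` S.
  move=> y /=; rewrite in_itv/= /S/= => /andP[_ yb].
  by apply: lt_le_trans (ler_norm _); rewrite /b in yb; lra.
have : ((ln (1 + L / (x - b)))%:E <= M%:E)%E.
  rewrite -integral_cauchy_kernel// -ME.
  apply: (@le_trans _ _ (\int[mu]_(y in `](b - L)%R, b]) `|k y|)%E).
    rewrite le_eqVlt; apply/orP; left; apply/eqP/eq_integral => y.
    rewrite inE/= in_itv/= => /andP[_ yb].
    rewrite /k/= indicE in_setT mul1r ger0_norm// invr_ge0.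
    by rewrite subr_ge0 ltW// (le_lt_trans yb).
  apply: ge0_subset_integral => //.
  by have /integrable_abse/measurable_int := ki.
have -> : x - b = 2 by rewrite /b opprB addrCA subrr addr0.
rewrite /L mulrAC divff// mul1r lee_fin leNgt => /negP; apply.
rewrite -[ltLHS]expRK ltr_ln ?posrE ?expR_gt0//.
by rewrite ltrDr.
Qed.

End hilbert.

(** * Geometric decay of [W] from the weak-type bound *)

Section necessity.
Context {R : realType}.
Local Notation mu := (@lebesgue_measure R).
Implicit Types (u w : R -> R).

Lemma lebesgue_ae_ex (P : R -> Prop) : {ae mu, forall x, P x} -> exists x, P x.
Proof.
have muT : (0 < mu [set: R])%E.
  rewrite -set_itvNyy lebesgue_measure_itv; exact: lt0y.
by move=> /(@filter_ex _ _ (ae_properfilter_algebraOfSetsType muT)).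
Qed.

(* If [u] were finite then the constant function [1] would belong to the Lorentz
   space, but its truncated Hilbert transforms diverge. *)
Lemma hilbert_bounded_umeas_ge u w (p r : R) : weightR u -> weightRp w ->
  0 < p -> 0 < r -> hilbert_bounded u w p ->
  exists c l : R, 0 < l /\ (r%:E <= umeas u `]c, (c + l)%R])%E.
Proof.
move=> wu ww p0 r0 [C HC]; apply: contrapT => Hno.
have uT : (umeas u setT <= r%:E)%E.
  apply: umeas_setT_le => // -[|n].
    by rewrite oppr0 set_itvoc0 /umeas integral_set0 lee_fin ltW.
  rewrite leNgt; apply/negP => /ltW rn; apply: Hno.
  exists (- n.+1%:R), (n.+1%:R + n.+1%:R); split; first by rewrite addr_gt0.
  by rewrite addrA addNr add0r.
have [Hf [_ [pv _]]] := HC _ (in_lorentz_indic _ _ _ _ _ wu ww p0 measurableT uT).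
have [x [/(_ 1 ltr01) ki _]] := lebesgue_ae_ex _ pv.
exact: cauchy_kernel_not_integrable ki.
Qed.

(** [K] is built from the operator bound and [p] alone, hence serves every [r]. *)
Lemma hilbert_bounded_Wfun_half u w (p : R) : weightR u -> weightRp w ->
  0 < p -> hilbert_bounded u w p ->
  exists2 K : R, 2 <= K &
    forall r : R, 0 < r -> (2%:E * Wfun w (r / K) <= Wfun w r)%E.
Proof.
move=> wu ww p0 hb; have [C0 HC0] := hb.
(* [C0] may be nonpositive; a positive constant can be cancelled later. *)
pose C := Num.max C0 1.
have C1 : 1 <= C by rewrite le_max lexx orbT.
have Cgt0 : 0 < C by exact: lt_le_trans C1.
(* The power of [2] becomes the factor [2] in front of [W] once [p]-th powers are taken. *)
pose lam := C * 2 `^ p^-1.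
have lam0 : 0 < lam by rewrite mulr_gt0// powR_gt0.
(* Makes [n.+1 / 2] exceed [expR (pi * lam)], so that the logarithm reaches [pi * lam]. *)
pose n := Num.truncn (2 * expR (pi * lam)).
have nlam : lam <= pi^-1 * ln (1 + n.+1%:R / 2).
  rewrite mulrC ler_pdivlMr ?pi_gt0// mulrC -ler_expR lnK; last first.
    by rewrite posrE addr_gt0// divr_gt0.
  apply: ltW; rewrite -[ltLHS]add0r ltrD// ltr_pdivlMr// [ltLHS]mulrC; exact: truncnS_gt.
pose N : R := n.+1%:R.
have N0 : 0 < N by rewrite ltr0n.
have N1 : 1 <= N by rewrite ler1n.
(* The extra factor [2] makes [t = r / (2 * N)] strictly smaller than [r / N], as the strict
   inequality in [rearr_ge_of_level] demands. *)
exists (2 * N); first by lra.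
move=> r r0; set t := r / (2 * N).
have t0 : 0 < t by rewrite divr_gt0// mulr_gt0.
have trN : t < r / N.
  rewrite /t invfM mulrCA gtr_pMl ?divr_gt0// invf_lt1//; lra.
have [c [l [l0 rcl]]] := hilbert_bounded_umeas_ge _ _ _ _ wu ww p0 r0 hb.
have [b [h [h0 uE uN]]] := umeas_selection _ _ _ _ n wu r0 l0 rcl.
have h20 : 0 < h / 2 by rewrite divr_gt0.
have inE := in_lorentz_indic _ _ _ _ _ wu ww p0 (measurable_itv _) uE.
have intE := lorentz_int_indic _ _ _ _ _ wu ww p0 (measurable_itv _) uE.
have [Hf [mHf [pv weak]]] := HC0 _ inE.
(* For each [y < lam], almost all of the right neighbour, of mass at least [r / N > t], lies in the
   level set of [Hf]. *)
have lamH : (lam%:E <= rearr u Hf t)%E.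
  apply: rearr_ge_of_level => y y0 ylam.
  apply: (@lt_le_trans _ _ (r / N)%:E); first by rewrite lte_fin.
  apply: (le_trans uN); apply: le_ae_umeas => //.
    have -> : [set x | y < `|Hf x|] = (fun x => `|Hf x|) @^-1` `]y, +oo[.
      by apply/seteqP; split=> x /=; rewrite in_itv/= andbT.
    rewrite -[X in measurable X]setTI.
    by apply: (measurableT_comp (@normr_measurable R setT) mHf).
  apply: lebesgue_aeS pv => x /= pvx; rewrite in_itv/= => /andP[bx xbN].
  rewrite (hilbert_pv_indic_itv _ _ _ _ h20 bx pvx).
  apply: lt_le_trans (ler_norm _); apply: (lt_le_trans ylam).
  apply: (le_trans nlam); rewrite ler_pM2l ?invr_gt0 ?pi_gt0//.
  have xb0 : 0 < x - b by rewrite subr_gt0.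
  (* From [x - b <= h / N] follows [(h / 2) / (x - b) >= N / 2]. *)
  rewrite ler_ln ?posrE ?addr_gt0 ?divr_gt0// lerD2l.
  rewrite ler_pdivlMr// -/N.
  have : x - b <= h / N by rewrite lerBlDl.
  by rewrite ler_pdivlMr//; lra.
have W0 s := Wfun_ge0 w s ww.
have WE s : exists2 a : R, 0 <= a & Wfun w s = a%:E.
  exists (fine (Wfun w s)); first exact: fine_ge0.
  by rewrite fineK// Wfun_fin_num.
have [a a0 Wt] := WE t; have [d d0 Wr] := WE r.
have pi0 : 0 <= p^-1 by rewrite invr_ge0 ltW.
have key : lam * a `^ p^-1 <= C * d `^ p^-1.
  rewrite -lee_fin (EFinM lam (a `^ p^-1)) (EFinM C (d `^ p^-1)) -(poweR_EFin a) -(poweR_EFin d) -Wt -Wr.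
  apply: (@le_trans _ _ (rearr u Hf t * poweR (Wfun w t) p^-1)%E).
    by rewrite lee_wpmul2r// poweR_ge0.
  apply: le_trans (_ : _ <= C0%:E * lorentz_norm u w p (\1_(`](b - h / 2)%R, b])))%E _.
    apply: le_trans weak; apply: ereal_sup_ubound; exists t => //=.
    by rewrite in_itv/= andbT.
  apply: (@le_trans _ _ (C%:E * lorentz_norm u w p (\1_(`](b - h / 2)%R, b])))%E).
    by rewrite lee_wpmul2r ?poweR_ge0// lee_fin le_max lexx.
  apply: lee_wpmul2l; first by rewrite lee_fin ltW.
  have l0' : (0 <= lorentz_int u w p (\1_(`](b - h / 2)%R, b])))%E.
    apply: integral_ge0 => s /=; rewrite in_itv/= andbT => s0.
    by rewrite mule_ge0 ?poweR_ge0// lee_fin; case: ww => + _; exact.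
  by apply: gt0_ler_poweR => //; rewrite in_itv/= leey andbT// W0.
rewrite Wt Wr -EFinM lee_fin.
have {}key : (2 * a) `^ p^-1 <= d `^ p^-1.
  by rewrite powRM// -(ler_pM2l Cgt0) mulrA.
have := ge0_ler_powR (ltW p0) _ _ key.
rewrite -!powRrM mulVf ?gt_eqF// !powRr1 ?mulr_ge0//; apply; rewrite nnegrE powR_ge0//.
Qed.

End necessity.

(** * Summation over geometric shells *)

Section B_star.
Context {R : realType}.
Local Notation mu := (@lebesgue_measure R).

Lemma B_star_infty_of_half (w : R -> R) (K : R) : weightRp w -> 2 <= K ->
  (forall r : R, 0 < r -> (2%:E * Wfun w (r / K) <= Wfun w r)%E) ->
  B_star_infty w.
Proof.
move=> ww K2 half; have K1 : 1 < K by apply: lt_le_trans K2; rewrite ltr1n.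
have K0 : 0 < K by exact: lt_trans K1.
have WE t : exists V : R, Wfun w t = V%:E.
  by exists (fine (Wfun w t)); rewrite fineK// Wfun_fin_num.
have [V {}WE] := choice WE.
have V0 t : 0 <= V t by rewrite -lee_fin -WE Wfun_ge0.
have leV s t : s <= t -> V s <= V t.
  by move=> st; rewrite -lee_fin -!WE; exact: le_Wfun.
pose g (t : R) := (V t * t^-1)%:E.
have gE D : (\int[mu]_(t in D) (Wfun w t * (t^-1)%:E) = \int[mu]_(t in D) g t)%E.
  by apply: eq_integral => t _; rewrite WE -EFinM.
have mg : measurable_fun (`]0, +oo[%classic : set R) g.
  apply/measurable_EFinP; apply: measurable_funM.
    exact: nondecreasing_measurable.
  apply: open_continuous_measurable_fun; first exact: interval_open.
  move=> t; rewrite inE/= in_itv/= andbT => t0.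
  by apply: cvgV; [rewrite gt_eqF|exact: cvg_id].
have mgS (a b : R) : 0 <= a -> measurable_fun (`]a, b]%classic : set R) g.
  move=> a0; apply: measurable_funS mg => // t /=.
  by rewrite !in_itv/= andbT => /andP[+ _]; exact: le_lt_trans.
have g0 (a b t : R) : 0 <= a -> `]a, b]%classic t -> (0 <= g t)%E.
  move=> a0 /=; rewrite in_itv/= => /andP[at_ _].
  by rewrite lee_fin mulr_ge0// invr_ge0 ltW// (le_lt_trans a0).
have rK r : 0 < r -> 0 < r / K by move=> r0; rewrite divr_gt0.
(* On the shell the integrand is at most [V r / (r / K)] and the length is [r - r / K], giving
   [(K - 1) * V r]. *)
have shell r : 0 < r -> (\int[mu]_(t in `](r / K)%R, r]) g t <= (K * V r)%:E)%E.
  move=> r0; have rKr : r / K < r by rewrite gtr_pMr// invf_lt1.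
  have mI : measurable (`](r / K)%R, r]%classic : set R) by exact: measurable_itv.
  apply: (@le_trans _ _ (\int[mu]_(t in `](r / K)%R, r]) (V r * (r / K)^-1)%:E)%E).
    apply: ge0_le_integral => //.
    - by move=> t; apply: g0; rewrite ltW// rK.
    - by apply: mgS; rewrite ltW// rK.
    - move=> t /=; rewrite in_itv/= => /andP[rt tr]; rewrite lee_fin.
      have t0 : 0 < t by apply: lt_trans rt; exact: rK.
      by rewrite ler_pM ?leV// ?invr_ge0 ?ltW// ltf_pV2 ?posrE ?rK.
  rewrite integral_cst//= lebesgue_measure_itv/= lte_fin rKr -EFinB -EFinM lee_fin.
  have -> : V r * (r / K)^-1 * (r - r / K) = K * V r - V r.
    by field; rewrite !gt_eqF.
  by rewrite gerBl.
(* The constant [2 * K] reproduces itself: halving gives [2 * K * V (r / K) <= K * V r], and the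
   outer shell adds [K * V r]. All [r] are covered at once because the induction hypothesis is used
   at [r / K]. *)
have partial n : forall r, 0 < r ->
    (\int[mu]_(t in `](r / K ^+ n)%R, r]) g t <= (2 * K * V r)%:E)%E.
  elim: n => [|n ih] r r0.
    by rewrite expr0 divr1 set_itvoc0 integral_set0 lee_fin !mulr_ge0// ltW.
  have rKn : 0 < r / K ^+ n.+1 by rewrite divr_gt0// exprn_gt0.
  have rKE : r / K ^+ n.+1 = r / K / K ^+ n by rewrite exprS invfM mulrA.
  have le1 : r / K ^+ n.+1 <= r / K.
    rewrite rKE ler_pdivrMr ?exprn_gt0// ler_peMr// ?(ltW (rK _ _))//.
    by rewrite exprn_ege1// ltW.
  have le2 : r / K <= r by rewrite ler_pdivrMr// ler_peMr// ltW.
  have -> : `](r / K ^+ n.+1)%R, r]%classic =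
      `](r / K ^+ n.+1)%R, (r / K)%R]%classic `|` `](r / K)%R, r]%classic.
    by rewrite -itv_bndbnd_setU ?bnd_simp.
  rewrite ge0_integral_setU//.
  - apply: (@le_trans _ _ ((2 * K * V (r / K))%:E + (K * V r)%:E)%E).
      by apply: leeD; [rewrite rKE; apply: ih; exact: rK|exact: shell].
    rewrite -EFinD lee_fin; have := half r r0; rewrite !WE -EFinM lee_fin.
    by move=> /(ler_wpM2l (ltW K0)); lra.
  - by rewrite -itv_bndbnd_setU ?bnd_simp//; apply: mgS; exact: ltW.
  - move=> t; rewrite -itv_bndbnd_setU ?bnd_simp//; apply: g0; exact: ltW.
  - apply/disj_setPS => x [/=]; rewrite !in_itv/= => /andP[_ xb] /andP[bx _].
    by have := lt_le_trans bx xb; rewrite ltxx.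
exists (2 * K); split; first by rewrite mulr_gt0.
move=> r r0; rewrite gE WE -EFinM.
pose G n := `](r / K ^+ n)%R, r]%classic : set R.
have -> : `]0%R, r]%classic = \bigcup_n G n.
  apply/seteqP; split => [t /=|t [n _]]; rewrite /G/= !in_itv/=; last first.
    by move=> /andP[+ ->]; rewrite andbT; apply: le_lt_trans; rewrite divr_ge0 ?exprn_ge0// ltW.
  move=> /andP[t0 tr].
  (* This exponent [n] gives [r / t < 2 ^+ n], and [2 <= K] lifts the bound to [K ^+ n]. *)
  exists (Num.Def.archi_bound (r / t)) => //=; rewrite in_itv/= tr andbT.
  rewrite ltr_pdivrMr ?exprn_gt0// -ltr_pdivrMl// mulrC.
  apply: lt_le_trans (upper_nthrootP (leqnn _)) _.
  by rewrite lerXn2r ?nnegrE// ltW.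
have cG : (\int[mu]_(t in G n) g t)%E @[n --> \oo] -->
       (\int[mu]_(t in \bigcup_n G n) g t)%E.
  apply: ge0_nondecreasing_set_cvg_integral => //.
  - move=> m n mn; apply/subsetPset => x; rewrite /G/= !in_itv/=.
    move=> /andP[+ ->]; rewrite andbT; apply: le_lt_trans.
    rewrite ler_pM2l// lef_pV2 ?posrE ?exprn_gt0//.
    by apply: ler_weXn2l => //; exact: ltW.
  - by move=> n; exact: measurable_itv.
  - by move=> n; apply: mgS; rewrite divr_ge0 ?exprn_ge0// ltW.
  - by move=> n t; apply: g0; rewrite divr_ge0 ?exprn_ge0// ltW.
have <- := cvg_lim _ cG => //.
(* The bound in [partial] is uniform in [n], so it passes to the monotone limit. *)
apply: lime_le; first exact: cvgP cG.
by apply: nearW => n; exact: partial.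
Qed.

End B_star.

Theorem theorem3p6 (R : realType) (u w : R -> R) (p : R) :
  weightR u -> weightRp w -> 0 < p -> hilbert_bounded u w p -> B_star_infty w.
Proof.
move=> wu ww p0 hb.
have [K K2 half] := hilbert_bounded_Wfun_half _ _ _ wu ww p0 hb.
exact: B_star_infty_of_half half.
Qed.
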